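(* Let $G$ be a graph with $n$ vertices. If $\alpha_{ir}(G) = 1$, then (i) $\langle N_i, N_j\rangle$ is a complete bipartite graph (with partite sets $N_i$ and $N_j$) for any $i,j \in D(G)$ with $i \neq j$; (ii) the subgraph of $G$ induced by $N_k$ is $(k+n_k-n)$-regular for any $k \in D(G)$.
   Context: All graphs are finite, simple, undirected and have at least one vertex. An irregular independent set of $G$ is an independent set $A$ of $G$ such that any two distinct vertices in $A$ have different degrees in $G$; $\alpha_{ir}(G)$ is the size of a largest irregular independent set of $G$. $D(G)$ denotes the set of degrees of vertices of $G$. For $i \in D(G)$, $N_i$ denotes the set of vertices of $G$ of degree $i$, and $n_i = |N_i|$. For two disjoint subsets $X$ and $Y$ of $V(G)$, $\langle X,Y\rangle$ denotes the subgraph of $G$ with vertex set $X \cup Y$ and edge set $\{\{x,y\} \in E(G) : x \in X, y \in Y\}$. *)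

(* Defs.v *)
From mathcomp Require Import all_boot all_order all_algebra.

Set Implicit Arguments.
Unset Strict Implicit.
Unset Printing Implicit Defensive.

Record sgraph := SGraph {
  vertex :> finType;
  adj : rel vertex;
  adj_sym : symmetric adj;
  adj_irrefl : irreflexive adj
}.

Definition deg (G : sgraph) (x : G) : nat := #|[set y | adj x y]|.

Definition degrees (G : sgraph) : seq nat := codom (@deg G).

Definition Ndeg (G : sgraph) (i : nat) : {set G} := [set x | deg x == i].

Definition independent (G : sgraph) (A : {set G}) : bool :=
  [forall x in A, forall y in A, ~~ adj x y].

Definition irregular_independent (G : sgraph) (A : {set G}) : bool :=
  independent A &&
  [forall x in A, forall y in A, (x != y) ==> (deg x != deg y)].

Definition alpha_ir (G : sgraph) : nat :=
  \max_(A : {set G} | irregular_independent A) #|A|.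

Section Subgraphs.

Variable G : sgraph.

Section Induced.

Variable S : {set G}.

Definition induced_adj : rel {x : G | x \in S} :=
  fun u v => adj (val u) (val v).

Lemma induced_adj_sym : symmetric induced_adj.
Proof. by move=> u v; apply: adj_sym. Qed.

Lemma induced_adj_irrefl : irreflexive induced_adj.
Proof. by move=> u; apply: adj_irrefl. Qed.

Definition induced : sgraph := SGraph induced_adj_sym induced_adj_irrefl.

End Induced.

Section Between.

Variables X Y : {set G}.

Definition between_adj : rel {x : G | x \in X :|: Y} :=
  fun u v => adj (val u) (val v) &&
    ((val u \in X) && (val v \in Y) || (val u \in Y) && (val v \in X)).

Lemma between_adj_sym : symmetric between_adj.
Proof.
by move=> u v; rewrite /between_adj adj_sym orbC andbC [_ && (val u \in Y)]andbC
  [_ && (val u \in X)]andbC andbC.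
Qed.

Lemma between_adj_irrefl : irreflexive between_adj.
Proof. by move=> u; rewrite /between_adj adj_irrefl. Qed.

(* The graph <X, Y>; it is meant for disjoint X and Y. *)
Definition between : sgraph := SGraph between_adj_sym between_adj_irrefl.

End Between.

End Subgraphs.

Definition complete_bipartite (H : sgraph) (A B : {set H}) : Prop :=
  [/\ A != set0, B != set0, [disjoint A & B], A :|: B = setT &
      forall x y : H,
        adj x y = (x \in A) && (y \in B) || (x \in B) && (y \in A)].

(* The degree r is an integer, so that it may be given by a difference that is
   not known in advance to be nonnegative. *)
Definition regular (H : sgraph) (r : int) : Prop :=
  forall x : H, Posz (deg x) = r.

(* Main.v *)
Require Import Defs.
From mathcomp Require Import all_boot all_order all_algebra.

(* If alpha_ir(G) = 1, two nonadjacent vertices x, y of different degrees would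
   form an irregular independent set of size 2; so any two vertices of different
   degrees are adjacent, which is (i).  Hence a vertex of degree k has all the
   n - n_k vertices outside N_k as neighbours, and k - (n - n_k) neighbours
   inside N_k, which is (ii). *)

Lemma adj_deg_neq (G : sgraph) (x y : G) :
  alpha_ir G = 1 -> deg x != deg y -> adj x y.
Proof.
move=> alpha1 dxy; apply/negPn/negP => nxy.
have neq_xy : x != y by apply: contraNneq dxy => ->.
suff irr : irregular_independent [set x; y].
  have := leq_bigmax_cond (F := fun A : {set G} => #|A|) _ irr.
  by rewrite -/(alpha_ir G) alpha1 cards2 neq_xy.
have nyx : ~~ adj y x by rewrite adj_sym.
apply/andP; split; apply/forall_inP => u /set2P hu;
  apply/forall_inP => v /set2P hv.
  by case: hu hv => -> [] ->; rewrite ?adj_irrefl.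
by case: hu hv => -> [] ->; rewrite ?eqxx ?[deg y == _]eq_sym ?dxy ?implybT.
Qed.

Lemma Ndeg_neq0 (G : sgraph) (i : nat) :
  i \in degrees G -> exists x : G, x \in Ndeg G i.
Proof. by case/codomP => x ->; exists x; rewrite inE. Qed.

(** The injection [val] carries the neighbours of [u] in [induced S] onto its neighbours in [G] that
    lie in [S]. *)
Lemma deg_induced (G : sgraph) (S : {set G}) (u : induced S) :
  deg u = #|[set y | adj (val u) y] :&: S|.
Proof.
rewrite /deg -(card_imset _ val_inj); apply: eq_card => y.
apply/imsetP/setIP => [[v]|[]].
  move=> uv ->; rewrite inE; split; last exact: valP v.
  by move: uv; rewrite (in_set (adj u)).
by rewrite inE => uy yS; exists (Sub y yS); rewrite ?inE.
Qed.

Theorem lemma3p1 (G : sgraph) (n : nat) (hn : #|G| = n) (n_gt0 : 0 < n)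
    (halpha : alpha_ir G = 1) :
  (forall i j : nat, i \in degrees G -> j \in degrees G -> i <> j ->
     complete_bipartite (H := between (Ndeg G i) (Ndeg G j))
       [set u | val u \in Ndeg G i] [set u | val u \in Ndeg G j]) /\
  (forall k : nat, k \in degrees G ->
     regular (induced (Ndeg G k))
       (Posz k + Posz #|Ndeg G k| - Posz n)%R).
Proof.
split=> [i j /Ndeg_neq0[x xi] /Ndeg_neq0[y yj] /eqP neq_ij | k _ u].
  have xU : x \in Ndeg G i :|: Ndeg G j by rewrite inE xi.
  have yU : y \in Ndeg G i :|: Ndeg G j by rewrite inE yj orbT.
  split.
  - by apply/set0Pn; exists (Sub x xU); rewrite inE.
  - by apply/set0Pn; exists (Sub y yU); rewrite inE.
  - apply/pred0P => u /=; rewrite !inE.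
    by apply: contraNF neq_ij => /andP[/eqP du /eqP dv]; rewrite -(etrans (esym du) dv).
  - by apply/setP => u; have := valP u; rewrite !inE.
  - move=> u v; rewrite /= /between_adj !inE.
    (* It remains to see that lying on opposite sides forces adjacency in [G]: the degrees are then
       [i] and [j], which differ. *)
    apply: andb_idl => /orP[] /andP[/eqP du /eqP dv];
      by apply: adj_deg_neq => //; rewrite du dv // eq_sym.
have /eqP du : deg (val u) == k by have := valP u; rewrite inE.
have outside : [set y | adj (val u) y] :\: Ndeg G k = ~: Ndeg G k.
  apply/setP => y; rewrite !inE; apply: andb_idr => dy.
  by apply: adj_deg_neq => //; rewrite du eq_sym.
have := cardsID (Ndeg G k) [set y | adj (val u) y].
rewrite outside -deg_induced -[RHS]/(deg (val u)) du -hn -(cardsC (Ndeg G k)).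
(* Splitting the neighbourhood gave [d + a = k], and splitting the vertex set turned [n] into
   [b + a]; what is left is [d = (d + a) + b - (b + a)] over the integers. *)
move: (deg u) => d; move: #|~: _| #|Ndeg G k| => a b <-.
by rewrite [b + a]addnC -PoszD -addnA PoszD GRing.addrK.
Qed.
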